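(* Let $Q,T_1,T_2\in\mathcal{B}(\mathcal{H})$ be any contractions such that $T_1T_2=QT_2T_1$. Then there is a Hilbert space $\mathcal{K}$ containing $\mathcal{H}$, an isometric lift $\overline{Q}\in\mathcal{B}(\mathcal{K})$ of $Q$, and isometric lifts $V_1,V_2\in\mathcal{B}(\mathcal{K})$ of $T_1,T_2$ respectively, such that $V_1V_2=\overline{Q}V_2V_1$. Moreover, if $Q$ is an isometry, then $\overline{Q}$ can be chosen to be $Q\oplus qI$ with respect to the decomposition $\mathcal{K}=\mathcal{H}\oplus(\mathcal{K}\ominus\mathcal{H})$, for any complex number $q$ of modulus one.
   Context: All Hilbert spaces are complex; $\mathcal{B}(\mathcal{H})$ is the algebra of bounded linear operators on $\mathcal{H}$; containment of Hilbert spaces means containment as a closed linear subspace; a contraction is an operator of norm at most one. An operator $B\in\mathcal{B}(\mathcal{K})$ is a lift of $A\in\mathcal{B}(\mathcal{H})$, $\mathcal{H}\subseteq\mathcal{K}$, if $\mathcal{H}$ is invariant under $B^*$ and $B^*|_{\mathcal{H}}=A^*$; it is an isometric lift if in addition $B$ is an isometry. *)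

(* Defs.v *)
From HB Require Import structures.
From mathcomp Require Import all_boot all_order all_algebra.
From mathcomp Require Import all_classical all_reals all_analysis complex.
From mathcomp Require Import ring.

Set Implicit Arguments.
Unset Strict Implicit.
Unset Printing Implicit Defensive.

Import Order.TTheory GRing.Theory Num.Theory.
Import numFieldNormedType.Exports.

Local Open Scope classical_set_scope.
Local Open Scope ring_scope.

(* Complex Hilbert spaces over the complex field R[i] of a realType R; norms
   take their values in R[i].  The inner product is linear in its first
   argument and conjugate-linear in the second. *)
HB.mixin Record isHilbert (R : realType) H & CompleteNormedModule R[i] H := {
  hdot : {dot H for (@Num.conj R[i])};
  hdotE : forall x : H, hdot x x = `|x| ^+ 2 }.

#[short(type="hilbertType")]
HB.structure Definition Hilbert (R : realType) :=
  {H of CompleteNormedModule R[i] H & isHilbert R H}.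

Notation "''[' x , y ]" := (hdot x y) : ring_scope.

HB.mixin Record isBounded (K : numFieldType) (U V : normedModType K)
    (f : U -> V) := {
  bounded_subproof : exists M : K, forall x, `|f x| <= M * `|x| }.

#[short(type="boundedOp")]
HB.structure Definition BoundedOp (K : numFieldType) (U V : normedModType K) :=
  {f of @GRing.Linear K U V *:%R f & @isBounded K U V f}.

Notation "''B' ( H )" := (boundedOp H H) (at level 8, format "''B' ( H )").

Section HilbertTheory.
Variables (R : realType) (H : hilbertType R).
Implicit Types (x y z : H) (a c : R[i]).

Lemma hdotC x y : '[x, y] = Num.conj '[y, x].
Proof. by rewrite hermC expr0 mul1r. Qed.

Lemma normDZ_sqr x y a : `|x + a *: y| ^+ 2 =
  `|x| ^+ 2 + `|a| ^+ 2 * `|y| ^+ 2 +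
    (Num.conj a * '[x, y] + Num.conj (Num.conj a * '[x, y])).
Proof.
rewrite -hdotE hnormD expr0 mul1r /= !hdotE normrZ exprMn.
by rewrite (linearZr_LR (hdot : {dot H for _})).
Qed.

Lemma polar_bound (E N c : R[i]) : 0 < N ->
  (forall a, 0 <= E + `|a| ^+ 2 * N +
    (Num.conj a * c + Num.conj (Num.conj a * c))) ->
  `|c| ^+ 2 <= E * N.
Proof.
move=> N0 /(_ (- (c / N))).
have NJ : Num.conj (N^-1) = N^-1.
  by apply: CrealP; rewrite realV ger0_real// ltW.
have -> : Num.conj (- (c / N)) * c = - (`|c| ^+ 2 / N).
  by rewrite rmorphN rmorphM/= NJ normCK mulNr; congr (- _); ring.
have -> : Num.conj (- (`|c| ^+ 2 / N)) = - (`|c| ^+ 2 / N).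
  by apply: CrealP; rewrite rpredN rpredM ?rpredX ?realV ?ger0_real// ltW.
have -> : `|- (c / N)| ^+ 2 * N = `|c| ^+ 2 / N.
  rewrite normrN normrM normrV ?unitfE ?gt_eqF// (gtr0_norm N0).
  by field; rewrite gt_eqF.
have -> : E + `|c| ^+ 2 / N + (- (`|c| ^+ 2 / N) - `|c| ^+ 2 / N) =
  E - `|c| ^+ 2 / N by ring.
by rewrite subr_ge0 ler_pdivrMr.
Qed.

Lemma cauchy_schwarz x y : `|'[x, y]| <= `|x| * `|y|.
Proof.
have [->|y0] := eqVneq y 0; first by rewrite linear0r !normr0 mulr0.
rewrite -(@ler_pXn2r _ 2)// ?nnegrE ?mulr_ge0// exprMn.
apply: polar_bound => [|a]; first by rewrite exprn_gt0// normr_gt0.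
by rewrite -normDZ_sqr exprn_ge0.
Qed.

Lemma hdot_ext x y : (forall z, '[z, x] = '[z, y]) -> x = y.
Proof.
move=> xy; apply/eqP; rewrite -subr_eq0 -normr_eq0 -sqrf_eq0 -hdotE.
by rewrite linearBr/= xy subrr.
Qed.

Section Riesz.
Variables (f : {scalar H}) (M : R[i]).
Hypotheses (M0 : 0 <= M) (fM : forall x, `|f x| <= M * `|x|).

Let J x := `|x| ^+ 2 - (f x + Num.conj (f x)).

Let J_real x : J x \is Num.real.
Proof.
rewrite rpredB ?rpredX ?normr_real//.
have -> : f x + Num.conj (f x) = 2 * 'Re (f x) by rewrite ReE mulrC divfK.
by rewrite rpredM ?realn ?Creal_Re.
Qed.

Let J_lb x : - M ^+ 2 <= J x.
Proof.
have h : f x + Num.conj (f x) <= 2 * (M * `|x|).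
  have -> : f x + Num.conj (f x) = 2 * 'Re (f x).
    by rewrite ReE mulrC divfK.
  rewrite ler_pM2l// (le_trans _ (fM x))//.
  apply: le_trans (leif_normC_Re_Creal (f x)).1.
  by rewrite real_ler_norm// Creal_Re.
rewrite -subr_ge0.
have -> : J x - - M ^+ 2 = (`|x| - M) ^+ 2 +
   (2 * (M * `|x|) - (f x + Num.conj (f x))) by rewrite /J; ring.
rewrite addr_ge0 ?subr_ge0// real_exprn_even_ge0//.
by rewrite rpredB// ger0_real.
Qed.

Lemma riesz_approx (e : R) : 0 < e ->
  exists x, forall z, `|'[z, x] - f z| <= e%:C%C * `|z|.
Proof.
move=> e0.
pose S := range (fun x => complex.Re (J x)).
have lbS : has_lbound S.
  exists (complex.Re (- M ^+ 2)) => _ [x _ <-].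
  by have := J_lb x; rewrite lecE => /andP[].
have infS : has_inf S by split=> //; exists (complex.Re (J 0)), 0.
have [_ [x _ <-] xS] := inf_adherent (exprn_gt0 2 e0) infS.
exists x => z.
have [->|z0] := eqVneq z 0.
  by rewrite linear0l linear0 subr0 !normr0 mulr0.
rewrite -(@ler_pXn2r _ 2)// ?nnegrE ?mulr_ge0//; last by rewrite ler0c ltW.
have -> : `|'[z, x] - f z| = `|'[x, z] - Num.conj (f z)|.
  by rewrite hdotC -[in LHS](conjCK (f z)) -rmorphB norm_conjC.
rewrite exprMn; apply: polar_bound => [|a].
  by rewrite exprn_gt0// normr_gt0.
have : J x <= J (x + a *: z) + e%:C%C ^+ 2.
  rewrite -(RRe_real (J_real x)) -(RRe_real (J_real (x + a *: z))).
  rewrite -rmorphXn -rmorphD lecR ltW// (lt_le_trans xS)// lerD2r.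
  by apply: ge_inf => //; exists (x + a *: z).
rewrite -subr_ge0; congr (0 <= _).
rewrite /J; have -> : f (x + a *: z) = f x + a * f z by rewrite linearD linearZ.
rewrite /J normDZ_sqr !(rmorphD, rmorphM, rmorphB, rmorphN)/=.
rewrite !conjCK; ring.
Qed.

Lemma riesz : exists y, forall x, f x = '[x, y].
Proof.
pose e n : R := n.+1%:R^-1.
have e0 n : 0 < e n by rewrite invr_gt0.
have [u uP] := choice (fun n => riesz_approx (e0 n)).
have uE n m : `|u n - u m| <= (e n)%:C%C + (e m)%:C%C.
  have [->|d0] := eqVneq (u n - u m) 0.
    by rewrite normr0 addr_ge0// ler0c ltW.
  rewrite -(ler_pM2r (_ : 0 < `|u n - u m|)) ?normr_gt0// -expr2 -hdotE.
  set d := u n - u m.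
  have dd : '[d, d] = ('[d, u n] - f d) - ('[d, u m] - f d).
    have -> : '[d, d] = '[d, u n] - '[d, u m] by rewrite -linearBr.
    by ring.
  rewrite -(ger0_norm (_ : 0 <= '[d, d])); last by rewrite hdotE exprn_ge0.
  rewrite dd mulrDl; apply: le_trans (ler_normB _ _) _.
  by apply: lerD; apply: uP.
have eC (d : R[i]) : 0 < d -> \forall n \near \oo, (e n)%:C%C < d.
  move=> d0; have dr : (complex.Re d)%:C%C = d.
    by rewrite RRe_real// ger0_real// ltW.
  have rd0 : 0 < complex.Re d by rewrite -ltcR dr.
  near=> n; rewrite -dr ltcR; near: n.
  exact: (near_infty_natSinv_lt (PosNum rd0)).
have : cvg (u @ \oo).
  apply/cauchy_cvgP/cauchy_ballP => d d0.
  rewrite near_map2; near=> n m; rewrite -ball_normE/=.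
  rewrite (le_lt_trans (uE _ _))// [d]splitr ltrD//.
    by near: n; apply: eC; exact: divr_gt0.
  by near: m; apply: eC; exact: divr_gt0.
move=> /cvg_ex[y uy]; exists y => z; apply/eqP; rewrite -subr_eq0 -normr_le0.
apply/ler_addgt0Pl => d d0; rewrite addr0.
have z1 : 0 < `|z| + 1 by rewrite ltr_wpDl.
have d1 : 0 < d / 2 / (`|z| + 1) by rewrite !divr_gt0.
near \oo => n.
have yn : `|y - u n| <= d / 2 / (`|z| + 1).
  by near: n; move/cvgrPdist_le: (uy); apply.
have en : (e n)%:C%C <= d / 2 / (`|z| + 1).
  by apply/ltW; near: n; exact: eC.
have -> : f z - '[z, y] = - ('[z, y - u n] + ('[z, u n] - f z)).
  by rewrite linearBr/=; ring.
rewrite normrN (le_trans (ler_normD _ _))//.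
have h : d / 2 / (`|z| + 1) * `|z| <= d / 2.
  by rewrite mulrAC ler_pdivrMr// ler_pM2l ?divr_gt0// lerDl.
rewrite [leRHS]splitr lerD//.
  rewrite (le_trans (cauchy_schwarz _ _))// mulrC (le_trans _ h)//.
  exact: ler_wpM2r.
rewrite (le_trans (uP _ _))// (le_trans _ h)//; exact: ler_wpM2r.
Unshelve. all: by end_near. Qed.

End Riesz.
End HilbertTheory.

Section BoundedTheory.
Variables (R : realType) (H K : hilbertType R) (A : boundedOp H K).

Lemma bounded_ge0 : exists2 M : R[i], 0 <= M & forall x, `|A x| <= M * `|x|.
Proof.
have [M AM] := @bounded_subproof _ _ _ A.
exists `|M| => // x; rewrite (le_trans (AM x))//.
have M0 : 0 <= M * `|x| by rewrite (le_trans _ (AM x)).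
by rewrite -(ger0_norm M0) normrM normr_id.
Qed.

Lemma adjoint_exists :
  exists B : boundedOp K H, forall x y, '[A x, y] = '[x, B y].
Proof.
have [M M0 AM] := bounded_ge0.
have /choice[g gP] y : exists z, forall x, '[A x, y] = '[x, z].
  pose f x := '[A x, y].
  have fl : scalar f.
    by move=> a u v; rewrite /f linearP linearDl/= linearZl_LR.
  pose F : {scalar H} := HB.pack f (GRing.isLinear.Build R[i] H R[i] *%R f fl).
  apply: (@riesz _ _ F (M * `|y|)) => [|x]; first by rewrite mulr_ge0.
  by rewrite (le_trans (cauchy_schwarz _ _))// mulrAC ler_wpM2r.
have gl : linear g.
  move=> a u v; apply: hdot_ext => x.
  rewrite -gP !linearDr/= !(linearZr_LR (hdot : {dot _ for _})).
  by rewrite /= !gP.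
have gM y : `|g y| <= M * `|y|.
  have [->|g0] := eqVneq (g y) 0; first by rewrite normr0 mulr_ge0.
  rewrite -(ler_pM2r (_ : 0 < `|g y|)) ?normr_gt0// -expr2 -hdotE.
  rewrite -(ger0_norm (_ : 0 <= '[g y, g y])); last by rewrite hdotE exprn_ge0.
  rewrite -gP (le_trans (cauchy_schwarz _ _))// mulrAC ler_wpM2r//.
have gb : exists M : R[i], forall y, `|g y| <= M * `|y| by exists M.
pose B : boundedOp K H := HB.pack g
  (GRing.isLinear.Build R[i] K H *:%R g gl) (isBounded.Build R[i] K H g gb).
by exists B.
Qed.

Definition adjoint : boundedOp K H := sval (cid adjoint_exists).

Lemma adjointP x y : '[A x, y] = '[x, adjoint y].
Proof. exact: svalP (cid adjoint_exists) x y. Qed.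

(* The supremum is taken in R, which is why the R[i]-valued norm is projected
   to its real part. *)
Definition opnorm : R :=
  sup [set complex.Re `|A x| | x in [set x | `|x| <= 1]].

Definition contractive := opnorm <= 1.

Lemma contractiveP : contractive <-> forall x, `|A x| <= `|x|.
Proof.
have nE (x : K) : (complex.Re `|x|)%:C%C = `|x|.
  by rewrite RRe_real// normr_real.
have ne : [set complex.Re `|A x| | x in [set x | `|x| <= 1]] !=set0.
  by exists (complex.Re `|A 0|), 0 => //=; rewrite normr0.
split=> [A1 x|A1]; last first.
  apply: ge_sup => // _ [x /= x1 <-].
  by rewrite -lecR nE (le_trans (A1 x)).
have [->|x0] := eqVneq x 0; first by rewrite linear0 !normr0.
have [M M0 AM] := bounded_ge0.
have ub : has_ubound [set complex.Re `|A x| | x in [set x | `|x| <= 1]].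
  exists (complex.Re M) => _ [z /= z1 <-].
  rewrite -lecR nE RRe_real ?ger0_real// (le_trans (AM z))//.
  by rewrite ler_piMr.
have : `|A (`|x|^-1 *: x)| <= 1.
  rewrite -nE -(rmorph1 (real_complex R)) lecR (le_trans _ A1)//.
  by apply: ub_le_sup => //; exists (`|x|^-1 *: x) => //=; rewrite normfZV.
rewrite linearZ/= normrZ normfV normr_id mulrC ler_pdivrMr ?normr_gt0//.
by rewrite mul1r.
Qed.

Lemma isometry_normP :
  isometry (@hdot R K) (@hdot R H) A <-> forall x, `|A x| = `|x|.
Proof.
split=> [iA x|nA x y].
  by apply/eqP; rewrite -(@eqrXn2 _ 2)// -!hdotE iA.
apply/eqP; rewrite -subr_eq0; set d := _ - _.
have := normDZ_sqr (A x) (A y) d.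
rewrite -linearZ -linearD/= !nA normDZ_sqr => /addrI/eqP.
rewrite -subr_eq0 opprD addrACA -rmorphB -mulrBr -opprB -/d.
rewrite mulrN rmorphN rmorphM/= conjCK -opprD oppr_eq0 [d * _]mulrC -mulrC.
by rewrite -normCK -mulr2n mulrn_eq0/= sqrf_eq0 normr_eq0.
Qed.

End BoundedTheory.

(* A linear map iota : H -> K preserving inner products presents K as a Hilbert
   space containing H; its range is closed because H is complete. *)
Section Lift.
Variables (R : realType) (H K : hilbertType R) (iota : {linear H -> K}).

Definition isometric_embedding :=
  isometry (@hdot R K) (@hdot R H) iota.

(* The range of iota is invariant under the adjoint of B, which restricts there
   to the adjoint of A. *)
Definition is_lift (A : 'B(H)) (B : 'B(K)) :=
  forall h, adjoint B (iota h) = iota (adjoint A h).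

Definition isometric_lift (A : 'B(H)) (B : 'B(K)) :=
  is_lift A B /\ isometry (@hdot R K) (@hdot R K) B.

Definition ortho_compl : set K := [set k | forall h, '[k, iota h] = 0].

(* B = A (+) qI with respect to K = H (+) (K (-) H). *)
Definition is_dsum_scalar (A : 'B(H)) (q : R[i]) (B : 'B(K)) :=
  forall h k, ortho_compl k -> B (iota h + k) = iota (A h) + q *: k.

End Lift.

(* Main.v *)
Require Import Defs.
From HB Require Import structures.
From mathcomp Require Import all_boot all_order all_algebra.
From mathcomp Require Import all_classical all_reals all_analysis complex.
From mathcomp Require Import ring.

(** The proof follows Ando's construction of commuting isometric lifts.

   Schaeffer's lift of a contraction T is the lower triangular operator on
   H (+) X with entries T, C and M, where |C h|^2 = |h|^2 - |T h|^2, the operator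
   M is an isometry of X, and the ranges of C and M are orthogonal
   ([isometric_extension]).  Such lifts V1, V2, Vq of T1, T2, Q are easily chosen
   so that V1 V2 = Vq V2 V1 holds on X, since this only involves the isometries
   M1, M2 and J of X.  On H the two sides may differ: V1 V2 h and Vq V2 V1 h have the
   same component T1 T2 h = Q T2 T1 h in H, but different components in X.  Both
   sides being isometric, these components have the same inner products, hence
   correspond under a partial isometry of X.  Ando's idea is to extend it to a
   unitary V of X that intertwines the two sides, and to replace V1 and V2 by V V1
   and V2 V^-1 (with V extended by the identity of H).

   Here the unitary is made explicit.  When the components in X of V1 V2 h and
   Vq V2 V1 h' are orthogonal for all h and h', the vectors u = V1 V2 h and
   v = Vq V2 V1 h are exchanged by the orthogonal reflection that changes the sign of
   the closed span of the differences u - v and of their images under the powers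
   of V1 V2.  This reflection also commutes with V1 V2 on X
   ([correct_lifts]).  The orthogonality is obtained by making X = l2(Y) with
   Y = l2(E) roomy enough, and letting the various operators act in different
   positions of Y ([ando_lifts]).

   Since Vq is left alone by the correction, it may be prescribed.  For a contraction
   Q it is a Schaeffer lift of Q; for an isometry Q there is no defect to
   accommodate and Vq = Q (+) q I is allowed.

   The defects C are taken with values in l2(H), which avoids square roots of
   positive operators ([defect_normE]). *)

Set Implicit Arguments.
Unset Strict Implicit.
Unset Printing Implicit Defensive.

Import Order.TTheory GRing.Theory Num.Theory.
Import numFieldNormedType.Exports.

Local Open Scope classical_set_scope.
Local Open Scope ring_scope.

(** * Limits of complex numbers *)

Section ComplexSequences.
Variable R : realType.
Implicit Types u : nat -> R[i]^o.

Lemma cvg_complex_bounded_mono u M : (forall n, 0 <= u n) ->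
  {homo u : m n / (m <= n)%N >-> m <= n} -> (forall n, u n <= M) ->
  cvg (u @ \oo).
Proof.
move=> u0 umono uM.
have uE n : u n = (complex.Re (u n))%:C%C by rewrite RRe_real// ger0_real.
have ME : M = (complex.Re M)%:C%C.
  by rewrite RRe_real// ger0_real// (le_trans (u0 0%N)).
have : cvg ((fun n => complex.Re (u n)) @ \oo).
  apply: nondecreasing_is_cvgn => [m n mn|].
    by rewrite -lecR -!uE; exact: umono.
  by exists (complex.Re M) => _ [n _ <-]; rewrite -lecR -uE -ME.
move=> /cvg_ex[l ul]; apply/cvg_ex; exists (l%:C%C).
apply/cvgrPdist_lt => d d0.
have dE : (complex.Re d)%:C%C = d by rewrite RRe_real// gtr0_real.
have rd0 : 0 < complex.Re d by rewrite -ltcR dE.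
move/cvgrPdist_lt : ul => /(_ _ rd0); apply: filterS => n.
by rewrite [u n]uE -rmorphB/= normc_def/= expr0n/= addr0 sqrtr_sqr -{2}dE ltcR.
Qed.

Lemma cvg_conj u (l : R[i]^o) : u @ \oo --> l ->
  (fun n => Num.conj (u n) : R[i]^o) @ \oo --> (Num.conj l : R[i]^o).
Proof.
move=> ul; apply/cvgrPdist_lt => d d0.
move/cvgrPdist_lt : ul => /(_ _ d0); apply: filterS => n.
by rewrite -rmorphB norm_conjC.
Qed.

(** The order of [R[i]] is only partial: nonnegativity passes to the limit
   because it means [z = `|z|]. *)
Lemma cvg_complex_ge0 T (F : set_system T) {FF : ProperFilter F}
    (u : T -> R[i]^o) (l : R[i]^o) : u @ F --> l ->
  (\forall x \near F, 0 <= u x) -> 0 <= l.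
Proof.
move=> ul u0; suff -> : l = `|l| :> R[i]^o by exact: normr_ge0.
have ul' : u @ F --> (`|l| : R[i]^o).
  have : (fun x => `|u x| : R[i]^o) @ F --> (`|l| : R[i]^o) by exact: cvg_norm.
  apply: cvg_trans; apply: near_eq_cvg; apply: filterS u0 => x ux.
  by rewrite ger0_norm.
have hd := @norm_hausdorff _ R[i]^o.
exact: etrans (esym (cvg_lim hd ul)) (cvg_lim hd ul').
Qed.

End ComplexSequences.

(** * Hilbert sums *)

(** Reduces the convergence of a series of inner products to that of series of
   squared norms, whose partial sums are monotone. *)
Lemma hdot_polar (R : realType) (H : hilbertType R) (x y : H) :
  '[x, y] = 2^-1 * ((`|x + y| ^+ 2 - `|x| ^+ 2 - `|y| ^+ 2)
              + 'i * (`|x + 'i *: y| ^+ 2 - `|x| ^+ 2 - `|y| ^+ 2)).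
Proof.
have -> : x + y = x + 1 *: y by rewrite scale1r.
rewrite !normDZ_sqr normr1 normCi !expr1n !mul1r rmorph1 mul1r.
rewrite conjCi rmorphM/= rmorphN/= conjCi opprK.
set d := '[x, y]; set d' := Num.conj d.
have -> : forall a b : R[i], a + b + (d + d') - a - b +
  'i * (a + b + (- 'i * d + 'i * d') - a - b) =
  (d + d') + ('i ^+ 2) * (d' - d) by move=> a b; ring.
rewrite sqrCi.
have -> : d + d' + -1 * (d' - d) = 2 * d by ring.
by rewrite mulKf// pnatr_eq0.
Qed.

Lemma norm_sqrD_le (K : numDomainType) (V : normedZmodType K) (x y : V) :
  `|x + y| ^+ 2 <= 2 * `|x| ^+ 2 + 2 * `|y| ^+ 2.
Proof.
apply: (@le_trans _ _ ((`|x| + `|y|) ^+ 2)).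
  by rewrite ler_pXn2r ?nnegrE ?addr_ge0// ler_normD.
rewrite -subr_ge0.
have -> : 2 * `|x| ^+ 2 + 2 * `|y| ^+ 2 - (`|x| + `|y|) ^+ 2 =
  (`|x| - `|y|) ^+ 2 by ring.
by rewrite real_exprn_even_ge0// rpredB// normr_real.
Qed.

Section HilbertSum.
Variables (R : realType) (E : nat -> hilbertType R).
Implicit Types f g : forall n, E n.

(** A bound on the partial sums is all that convergence means here, the terms
   being nonnegative.  The family [E] may vary with the index, so that the same
   construction yields both l2(Y) and H (+) l2(Y). *)
Definition square_summable f := exists M : R[i],
  forall n, \sum_(i < n) `|f i| ^+ 2 <= M.

Record hsum := HSum { hseq :> forall n, E n; hsumP : square_summable hseq }.
Implicit Types u v w : hsum.

HB.instance Definition _ := gen_eqMixin hsum.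
HB.instance Definition _ := gen_choiceMixin hsum.

Lemma hsum_ext (u v : hsum) : (forall n, u n = v n) -> u = v.
Proof.
case: u v => [u uP] [v vP] /= uv; have uvE : u = v by exact/functional_extensionality_dep.
by case: _ / uvE vP => vP; congr HSum; exact: Prop_irrelevance.
Qed.

Lemma square_summable0 : square_summable (fun=> 0).
Proof. by exists 0 => n; rewrite big1// => i _; rewrite normr0 expr0n. Qed.

Lemma square_summableD f g : square_summable f -> square_summable g ->
  square_summable (fun n => f n + g n).
Proof.
move=> [M fM] [N gN]; exists (2 * M + 2 * N) => n.
apply: le_trans (_ : 2 * \sum_(i < n) `|f i| ^+ 2 +
  2 * \sum_(i < n) `|g i| ^+ 2 <= _); last by rewrite lerD// ler_pM2l.
rewrite !mulr_sumr -big_split/=; apply: ler_sum => i _.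
exact: norm_sqrD_le.
Qed.

Lemma square_summableZ (a : R[i]) f : square_summable f ->
  square_summable (fun n => a *: f n).
Proof.
move=> [M fM]; exists (`|a| ^+ 2 * M) => n.
apply: le_trans (_ : `|a| ^+ 2 * \sum_(i < n) `|f i| ^+ 2 <= _); last first.
  by rewrite ler_wpM2l// exprn_ge0.
by rewrite mulr_sumr; apply: ler_sum => i _; rewrite normrZ exprMn.
Qed.

Lemma square_summableN f : square_summable f ->
  square_summable (fun n => - f n).
Proof.
by move=> [M fM]; exists M => n; under eq_bigr do rewrite normrN.
Qed.

Definition hsum_zero := HSum square_summable0.
Definition hsum_add (u v : hsum) := HSum (square_summableD (hsumP u) (hsumP v)).
Definition hsum_opp (u : hsum) := HSum (square_summableN (hsumP u)).
Definition hsum_scale a (u : hsum) := HSum (square_summableZ a (hsumP u)).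

Lemma hsum_addA : associative hsum_add.
Proof. by move=> u v w; apply: hsum_ext => n /=; rewrite addrA. Qed.
Lemma hsum_addC : commutative hsum_add.
Proof. by move=> u v; apply: hsum_ext => n /=; rewrite addrC. Qed.
Lemma hsum_add0 : left_id hsum_zero hsum_add.
Proof. by move=> u; apply: hsum_ext => n /=; rewrite add0r. Qed.
Lemma hsum_addN : left_inverse hsum_zero hsum_opp hsum_add.
Proof. by move=> u; apply: hsum_ext => n /=; rewrite addNr. Qed.

HB.instance Definition _ := GRing.isZmodule.Build hsum
  hsum_addA hsum_addC hsum_add0 hsum_addN.

Lemma hsum_scaleA a b (u : hsum) :
  hsum_scale a (hsum_scale b u) = hsum_scale (a * b) u.
Proof. by apply: hsum_ext => n /=; rewrite scalerA. Qed.
Lemma hsum_scale1 : left_id 1 hsum_scale.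
Proof. by move=> u; apply: hsum_ext => n /=; rewrite scale1r. Qed.
Lemma hsum_scaleDr : right_distributive hsum_scale +%R.
Proof. by move=> a u v; apply: hsum_ext => n /=; rewrite scalerDr. Qed.
Lemma hsum_scaleDl (u : hsum) : {morph hsum_scale^~ u : a b / a + b}.
Proof. by move=> a b; apply: hsum_ext => n /=; rewrite scalerDl. Qed.

HB.instance Definition _ := GRing.Zmodule_isLmodule.Build R[i] hsum
  hsum_scaleA hsum_scale1 hsum_scaleDr hsum_scaleDl.

Lemma hsumDE (u v : hsum) n : (u + v) n = u n + v n. Proof. by []. Qed.
Lemma hsumBE (u v : hsum) n : (u - v) n = u n - v n. Proof. by []. Qed.
Lemma hsumZE a (u : hsum) n : (a *: u) n = a *: u n. Proof. by []. Qed.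

(** The values are put in the regular module [R[i]^o] because that is where
   the topology of the scalars lives. *)
Definition pdot (u v : hsum) (n : nat) : R[i]^o := \sum_(i < n) '[u i, v i].

Lemma pdotxx u n : pdot u u n = \sum_(i < n) `|u i| ^+ 2.
Proof. by apply: eq_bigr => i _; rewrite hdotE. Qed.

Lemma pdotxx_ge0 u n : 0 <= pdot u u n.
Proof. by rewrite pdotxx sumr_ge0// => i _; rewrite exprn_ge0. Qed.

Lemma pdotxx_mono u : {homo pdot u u : m n / (m <= n)%N >-> m <= n}.
Proof.
move=> m n mn; rewrite !pdotxx -(subnKC mn) big_split_ord/= lerDl.
by rewrite sumr_ge0// => i _; rewrite exprn_ge0.
Qed.

Lemma is_cvg_pdotxx u : cvg (pdot u u @ \oo).
Proof.
have [M uM] := hsumP u; apply: (@cvg_complex_bounded_mono _ _ M).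
- exact: pdotxx_ge0.
- exact: pdotxx_mono.
- by move=> n; rewrite pdotxx.
Qed.

Lemma pdot_polar u v : pdot u v = fun n => 2^-1 *:
  ((pdot (u + v) (u + v) n - pdot u u n - pdot v v n) + 'i *:
   (pdot (u + 'i *: v) (u + 'i *: v) n - pdot u u n - pdot v v n)).
Proof.
apply/funext => n; rewrite !pdotxx.
rewrite -!sumrB scaler_sumr -big_split/= scaler_sumr.
by apply: eq_bigr => i _; rewrite hdot_polar.
Qed.

Lemma is_cvg_pdot u v : cvg (pdot u v @ \oo).
Proof.
have c := is_cvg_pdotxx; rewrite pdot_polar.
apply: is_cvgZr; apply: is_cvgD; last apply: is_cvgZr.
  by apply: is_cvgB; [apply: is_cvgB; exact: c|exact: c].
by apply: is_cvgB; [apply: is_cvgB; exact: c|exact: c].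
Qed.

Definition hsum_dot u v : R[i] := limn (pdot u v).

Lemma cvg_pdot u v : pdot u v @ \oo --> (hsum_dot u v : R[i]^o).
Proof. exact: is_cvg_pdot. Qed.

Lemma pdot_unique u v (l : R[i]) :
  pdot u v @ \oo --> (l : R[i]^o) -> hsum_dot u v = l.
Proof. exact: (@cvg_lim _ (@norm_hausdorff _ R[i]^o)). Qed.

Lemma hsum_dotDl u v w : hsum_dot (u + v) w = hsum_dot u w + hsum_dot v w.
Proof.
apply: pdot_unique.
have -> : pdot (u + v) w = pdot u w \+ pdot v w.
  apply/funext => n; rewrite /pdot [RHS]/= -big_split; apply: eq_bigr => i _.
  by rewrite hsumDE linearDl.
by apply: cvgD; exact: cvg_pdot.
Qed.

Lemma hsum_dotZl a u w : hsum_dot (a *: u) w = a * hsum_dot u w.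
Proof.
apply: pdot_unique.
have -> : pdot (a *: u) w = fun n => a *: pdot u w n.
  apply/funext => n; rewrite /pdot scaler_sumr; apply: eq_bigr => i _.
  by rewrite hsumZE linearZl_LR.
by apply: cvgZr; exact: cvg_pdot.
Qed.

Lemma hsum_dotC u v : hsum_dot u v = Num.conj (hsum_dot v u).
Proof.
apply: pdot_unique.
have -> : pdot u v = fun n => Num.conj (pdot v u n).
  apply/funext => n; rewrite /pdot rmorph_sum.
  by apply: eq_bigr => i _; rewrite /= -hdotC.
by apply: cvg_conj; exact: cvg_pdot.
Qed.

Lemma hsum_dotDr u v w : hsum_dot w (u + v) = hsum_dot w u + hsum_dot w v.
Proof. by rewrite hsum_dotC hsum_dotDl rmorphD/= -!hsum_dotC. Qed.

Lemma hsum_dotZr a u w : hsum_dot w (a *: u) = Num.conj a * hsum_dot w u.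
Proof. by rewrite hsum_dotC hsum_dotZl rmorphM/= -hsum_dotC. Qed.

Lemma pdotxx_le u n : pdot u u n <= hsum_dot u u.
Proof.
rewrite -subr_ge0; apply: (@cvg_complex_ge0 _ _ \oo _ (fun m => pdot u u m - pdot u u n)).
  by apply: cvgB; [exact: cvg_pdot|exact: cvg_cst].
by exists n => // m /= nm; rewrite subr_ge0; exact: pdotxx_mono.
Qed.

Lemma hsum_dotxx_le u M : (forall n, \sum_(i < n) `|u i| ^+ 2 <= M) ->
  hsum_dot u u <= M.
Proof.
move=> uM; rewrite -subr_ge0.
apply: (@cvg_complex_ge0 _ _ \oo _ (fun m => M - pdot u u m : R[i]^o)).
  by apply: cvgB; [exact: cvg_cst|exact: cvg_pdot].
by exists 0%N => // m _; rewrite subr_ge0 pdotxx.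
Qed.

Lemma hsum_dotxx_ge0 u : 0 <= hsum_dot u u.
Proof. by rewrite (le_trans (pdotxx_ge0 u 0))// pdotxx_le. Qed.

Lemma coord_le u n : `|u n| ^+ 2 <= hsum_dot u u.
Proof.
apply: le_trans (pdotxx_le u n.+1); rewrite pdotxx big_ord_recr/= lerDr.
by rewrite sumr_ge0// => i _; rewrite exprn_ge0.
Qed.

Lemma hsum_dotxx_eq0 u : hsum_dot u u = 0 -> u = 0.
Proof.
move=> u0; apply: hsum_ext => n; apply/eqP.
by rewrite -normr_eq0 -sqrf_eq0 eq_le exprn_ge0// -[leRHS]u0 coord_le.
Qed.

Lemma hsum_dotxx_add u v a : hsum_dot (u + a *: v) (u + a *: v) =
  hsum_dot u u + `|a| ^+ 2 * hsum_dot v v +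
  (Num.conj a * hsum_dot u v + Num.conj (Num.conj a * hsum_dot u v)).
Proof.
rewrite hsum_dotDl !hsum_dotDr !hsum_dotZl !hsum_dotZr (hsum_dotC v u).
by rewrite rmorphM/= conjCK normCK; ring.
Qed.

Lemma hsum_cauchy_schwarz u v :
  `|hsum_dot u v| ^+ 2 <= hsum_dot u u * hsum_dot v v.
Proof.
have [v0|v0] := eqVneq (hsum_dot v v) 0.
  by rewrite (hsum_dotxx_eq0 v0) -[0](scale0r 0) !hsum_dotZr rmorph0 !mul0r
    mulr0 normr0 expr0n.
apply: polar_bound => [|a]; first by rewrite lt0r v0 hsum_dotxx_ge0.
by rewrite -hsum_dotxx_add hsum_dotxx_ge0.
Qed.

Definition hsum_norm u : R[i] := sqrtC (hsum_dot u u).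

Lemma hsum_norm_ge0 u : 0 <= hsum_norm u.
Proof. by rewrite sqrtC_ge0 hsum_dotxx_ge0. Qed.

Lemma hsum_norm_add u v : hsum_norm (u + v) <= hsum_norm u + hsum_norm v.
Proof.
rewrite -(@ler_pXn2r _ 2)// ?nnegrE ?addr_ge0 ?hsum_norm_ge0//.
rewrite sqrrD !sqrtCK -[v in hsum_dot (u + v) (u + v)]scale1r hsum_dotxx_add.
rewrite normr1 expr1n rmorph1 !mul1r [leLHS]addrAC lerD2r lerD2l.
set c := hsum_dot u v.
have -> : c + Num.conj c = 'Re c *+ 2 by rewrite ReE -mulr_natr divfK.
rewrite lerMn2r/=.
apply: le_trans (_ : `|c| <= _).
  apply: le_trans (leif_normC_Re_Creal c).1.
  by rewrite real_ler_norm// Creal_Re.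
rewrite -(@ler_pXn2r _ 2)// ?nnegrE ?mulr_ge0 ?hsum_norm_ge0//.
by rewrite exprMn !sqrtCK hsum_cauchy_schwarz.
Qed.

Lemma hsum_normZ a u : hsum_norm (a *: u) = `|a| * hsum_norm u.
Proof.
rewrite /hsum_norm hsum_dotZl hsum_dotZr mulrA -normCK.
by rewrite sqrtCM ?nnegrE ?exprn_ge0 ?hsum_dotxx_ge0// sqrCK.
Qed.

Lemma hsum_norm_eq0 u : hsum_norm u = 0 -> u = 0.
Proof. by move/eqP; rewrite sqrtC_eq0 => /eqP/hsum_dotxx_eq0. Qed.

HB.instance Definition _ := Lmodule_isNormed.Build R[i] hsum
  hsum_norm_add hsum_normZ hsum_norm_eq0.

Lemma hsum_normE u : `|u| ^+ 2 = hsum_dot u u.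
Proof. exact: sqrtCK. Qed.

Lemma hsum_coord_norm_le u n : `|u n| <= `|u|.
Proof.
by rewrite -(@ler_pXn2r _ 2)// ?nnegrE// hsum_normE coord_le.
Qed.

End HilbertSum.

Section HilbertSumComplete.
Variables (R : realType) (E : nat -> hilbertType R).
Local Notation S := (hsum E).

(** A Cauchy filter converges in every coordinate.  The limits [g n] form the
   limit: each estimate on finitely many coordinates of [v - u] passes to the
   limit in [v], uniformly in the number of coordinates. *)
Lemma hsum_complete (F : set_system S) : ProperFilter F -> cauchy F -> cvg F.
Proof.
move=> FF /cauchy_ballP Fc.
have cF n : cvg ((fun u : S => u n) @ F).
  apply/cauchy_cvgP/cauchy_ballP => d d0; rewrite near_map2.
  apply: filterS (Fc d d0) => -[x y]/=; rewrite -!ball_normE/=.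
  by apply: le_lt_trans; rewrite -hsumBE hsum_coord_norm_le.
pose g n : E n := lim ((fun u : S => u n) @ F).
have gP n : (fun u : S => u n) @ F --> g n by exact: cF.
have gF (e : R[i]) : 0 < e -> \forall u \near F,
    forall N, \sum_(i < N) `|g i - (u : S) i| ^+ 2 <= e ^+ 2.
  move=> e0; have [[P Q] /= [FP FQ] PQ] := Fc e e0.
  apply: filterS FP => u Pu N.
  rewrite -subr_ge0.
  apply: (@cvg_complex_ge0 _ _ F _ (fun v : S =>
    (e ^+ 2 - \sum_(i < N) `|v i - u i| ^+ 2 : R[i]^o))).
    apply: cvgB; first exact: cvg_cst.
    elim: N => [|N IH].
      by under eq_fun do rewrite big_ord0; rewrite big_ord0; exact: cvg_cst.
    under eq_fun do rewrite big_ord_recr/=; rewrite big_ord_recr/=.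
    apply: cvgD; first exact: IH.
    rewrite expr2; under eq_fun do rewrite expr2.
    have h : (fun v : S => `|v N - u N| : R[i]^o) @ F --> (`|g N - u N| : R[i]^o).
      by apply: cvg_norm; apply: cvgB; [exact: gP|exact: cvg_cst].
    exact: cvgM.
  apply: (@filterS _ F _ Q _ _ FQ) => v Qv; rewrite subr_ge0.
  have := PQ (u, v) (conj Pu Qv); rewrite /= -ball_normE/= => uve.
  apply: le_trans (_ : `|v - u| ^+ 2 <= _).
    by rewrite hsum_normE; apply: le_trans (pdotxx_le _ N); rewrite pdotxx.
  by rewrite ler_pXn2r ?nnegrE ?(ltW e0)// distrC ltW.
have [u0 gu0] : exists u0 : S, square_summable (fun n => g n - u0 n).
  by have [u uP] := filter_ex (gF 1 ltr01); exists u; exists (1 ^+ 2).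
have gS : square_summable g.
  have := square_summableD gu0 (hsumP u0).
  by congr square_summable; apply/functional_extensionality_dep => n;
    rewrite subrK.
apply/cvg_ex; exists (HSum gS); apply/cvgrPdist_le => e e0.
apply: filterS (gF e e0) => u ue.
by rewrite -(@ler_pXn2r _ 2)// ?nnegrE ?(ltW e0)// hsum_normE hsum_dotxx_le.
Qed.

HB.instance Definition _ := Uniform_isComplete.Build S hsum_complete.

Lemma hsum_dot_bilinear : bilinear_for *%R (Num.conj \; *%R) (@hsum_dot R E).
Proof.
split=> [u a v w|u a v w] /=; first by rewrite hsum_dotDl hsum_dotZl.
by rewrite hsum_dotDr hsum_dotZr.
Qed.

Lemma hsum_dot_hermitian (u v : S) :
  hsum_dot u v = (-1) ^+ false * Num.conj (hsum_dot v u).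
Proof. by rewrite mul1r hsum_dotC. Qed.

Lemma hsum_dot_gt0 (u : S) : u != 0 -> 0 < hsum_dot u u.
Proof. by move=> u0; rewrite -hsum_normE exprn_gt0// normr_gt0. Qed.

HB.instance Definition _ := bilinear_isBilinear.Build R[i] S S R[i] *%R
  (Num.conj \; *%R) (@hsum_dot R E) hsum_dot_bilinear.
HB.instance Definition _ := isHermitianSesquilinear.Build R[i] S false
  Num.conj (@hsum_dot R E) hsum_dot_hermitian.
HB.instance Definition _ := isDotProduct.Build R[i] S (@hsum_dot R E)
  hsum_dot_gt0.

Lemma hsum_dotE (u : S) :
  (@hsum_dot R E : {dot S for Num.conj}) u u = `|u| ^+ 2.
Proof. by rewrite hsum_normE. Qed.

HB.instance Definition _ := isHilbert.Build R S hsum_dotE.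

Lemma hdot_hsumE (u v : S) : '[u, v] = hsum_dot u v.
Proof. by []. Qed.

End HilbertSumComplete.

(** * Inner products and bounded operators *)

Section InnerProduct.
Variables (R : realType) (H : hilbertType R).
Implicit Types (x y z : H) (a : R[i]).

Lemma hdotDl x y z : '[x + y, z] = '[x, z] + '[y, z].
Proof. exact: linearDl. Qed.

Lemma hdotBl x y z : '[x - y, z] = '[x, z] - '[y, z].
Proof. exact: linearBl. Qed.

Lemma hdotZl a x z : '[a *: x, z] = a * '[x, z].
Proof. exact: linearZl_LR. Qed.

Lemma hdotDr x y z : '[z, x + y] = '[z, x] + '[z, y].
Proof. exact: linearD. Qed.

Lemma hdotBr x y z : '[z, x - y] = '[z, x] - '[z, y].
Proof. exact: linearB. Qed.

Lemma hdotZr a x z : '[z, a *: x] = Num.conj a * '[z, x].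
Proof. exact: linearZr_LR. Qed.

Lemma hdot_eq0C x y : '[x, y] = 0 -> '[y, x] = 0.
Proof. by rewrite (hdotC y) => ->; rewrite rmorph0. Qed.

Lemma eq_dot_norm2 (G : hilbertType R) (x : H) (y : G) :
  '[x, x] = '[y, y] -> `|x| ^+ 2 = `|y| ^+ 2.
Proof. by rewrite !hdotE. Qed.

End InnerProduct.

Section Operators.
Variables (R : realType) (H K : hilbertType R) (f : H -> K).
Hypothesis fl : linear f.

Definition bounded_linear (fb : exists M : R[i], forall x, `|f x| <= M * `|x|) :
  boundedOp H K := HB.pack f (GRing.isLinear.Build R[i] H K *:%R f fl)
                             (isBounded.Build R[i] H K f fb).

Lemma dot_preserving_bounded : (forall x y, '[f x, f y] = '[x, y]) ->
  exists M : R[i], forall x, `|f x| <= M * `|x|.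
Proof.
move=> fi; exists 1 => x; rewrite mul1r -(@ler_pXn2r _ 2)// ?nnegrE//.
by rewrite -!hdotE fi.
Qed.

Definition isometric_op (fi : forall x y, '[f x, f y] = '[x, y]) :=
  bounded_linear (dot_preserving_bounded fi).

End Operators.

Section OperatorAdditivity.
Variables (R : realType) (H K : hilbertType R) (A : boundedOp H K).

Lemma opD x y : A (x + y) = A x + A y. Proof. exact: linearD. Qed.
Lemma opB x y : A (x - y) = A x - A y. Proof. exact: linearB. Qed.

End OperatorAdditivity.

(** * Operators on Hilbert sums *)

Section HilbertSumCons.
Variables (R : realType) (E : nat -> hilbertType R).

(** [hcons], [htail] and the value at [0] identify the sum of [E] with the sum of
   [E 0] and of the shifted family. *)
Definition cons_fun (x : E 0%N) (u : forall n, E n.+1) : forall n, E n :=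
  fun n => if n is m.+1 then u m else x.

Lemma cons_summable x (u : hsum (fun n => E n.+1)) :
  square_summable (cons_fun x u).
Proof.
have [M uM] := hsumP u; exists (`|x| ^+ 2 + M) => -[|n].
  by rewrite big_ord0 addr_ge0 ?exprn_ge0// (le_trans _ (uM 0%N))// big_ord0.
by rewrite big_ord_recl lerD2l; exact: uM.
Qed.

Definition hcons x u : hsum E := HSum (cons_summable x u).

Lemma tail_summable (u : hsum E) :
  square_summable (fun n => u n.+1 : E n.+1).
Proof.
have [M uM] := hsumP u; exists M => n.
by apply: le_trans (uM n.+1); rewrite big_ord_recl lerDr exprn_ge0.
Qed.

Definition htail (u : hsum E) : hsum (fun n => E n.+1) := HSum (tail_summable u).

Lemma hcons_eta (u : hsum E) : hcons (u 0%N) (htail u) = u.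
Proof. by apply: hsum_ext => -[]. Qed.

Lemma htail_cons x (u : hsum (fun n => E n.+1)) : htail (hcons x u) = u.
Proof. exact: hsum_ext. Qed.

Lemma hconsP a x y (u v : hsum (fun n => E n.+1)) :
  hcons (a *: x + y) (a *: u + v) = a *: hcons x u + hcons y v.
Proof. by apply: hsum_ext => -[]. Qed.

Lemma htailP a (u v : hsum E) : htail (a *: u + v) = a *: htail u + htail v.
Proof. exact: hsum_ext. Qed.

Lemma hdot_cons x y (u v : hsum (fun n => E n.+1)) :
  '[hcons x u, hcons y v] = '[x, y] + '[u, v].
Proof.
rewrite hdot_hsumE; apply: pdot_unique.
rewrite -(cvg_shiftS (pdot (hcons x u) (hcons y v))).
have -> : (fun n => pdot (hcons x u) (hcons y v) n.+1) =
          (fun n => '[x, y] + pdot u v n).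
  by apply/funext => n; rewrite /pdot big_ord_recl.
by apply: cvgD; [exact: cvg_cst|exact: cvg_pdot].
Qed.

End HilbertSumCons.

Section DiagonalIsometry.
Variables (R : realType) (E : nat -> hilbertType R).
Variable g : forall n, {linear E n -> E n}.
Hypothesis gi : forall n x y, '[g n x, g n y] = '[x, y].

Lemma diag_summable (u : hsum E) : square_summable (fun n => g n (u n)).
Proof.
have [M uM] := hsumP u; exists M => n; rewrite (le_trans _ (uM n))//.
by apply: ler_sum => i _; rewrite -!hdotE gi.
Qed.

Definition hdiag (u : hsum E) : hsum E := HSum (diag_summable u).

Lemma hdiag_linear : linear hdiag.
Proof. by move=> a u v; apply: hsum_ext => n /=; rewrite linearP. Qed.

HB.instance Definition _ :=
  GRing.isLinear.Build R[i] (hsum E) (hsum E) *:%R hdiag hdiag_linear.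

Lemma hdiag_dot (u v : hsum E) : '[hdiag u, hdiag v] = '[u, v].
Proof.
by congr (limn _); apply/funext => n; apply: eq_bigr => i _; rewrite /= gi.
Qed.

End DiagonalIsometry.

(** * Defect operators without square roots *)

Section Defect.
Variables (R : realType) (H : hilbertType R) (T : 'B(H)).
Hypothesis Tc : contractive T.

Lemma adjoint_contractive y : `|adjoint T y| <= `|y|.
Proof.
have [->|Ty0] := eqVneq (adjoint T y) 0; first by rewrite normr0.
rewrite -(ler_pM2r (_ : 0 < `|adjoint T y|)) ?normr_gt0// -expr2 -hdotE.
rewrite -adjointP -[leLHS]ger0_norm; last by rewrite adjointP hdotE exprn_ge0.
apply: le_trans (cauchy_schwarz _ _) _; rewrite mulrC ler_wpM2l//.
exact: (contractiveP T).1.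
Qed.

(** [altpow k] is the alternating product [... T T* T] of [k] factors, so that
   [|altpow k x|^2 = <(T* T)^k x, x>] for every [k], even or odd. *)
Fixpoint altpow k (x : H) : H :=
  if k is k'.+1 then
    if odd k' then adjoint T (altpow k' x) else T (altpow k' x)
  else x.

Lemma altpow_linear k : linear (altpow k).
Proof.
by elim: k => [//|k IH] a x y /=; rewrite IH; case: odd; rewrite linearP.
Qed.

Lemma altpow_le k x : `|altpow k.+1 x| <= `|altpow k x|.
Proof.
by rewrite /=; case: odd; [exact: adjoint_contractive|exact: (contractiveP T).1].
Qed.

Lemma altpow_shift k x : altpow k (adjoint T (T x)) = altpow k.+2 x.
Proof. by elim: k => [//|k IH] /=; rewrite IH /= negbK. Qed.

Lemma altpow_dot k x : '[altpow k x, altpow k.+2 x] = `|altpow k.+1 x| ^+ 2.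
Proof.
rewrite -hdotE /=; case: odd => /=; last by rewrite -adjointP.
by rewrite hdotC adjointP -hdotC.
Qed.

(** With [X = T* T] and [b k = <X^k x, x>], the left-hand side is
   [<X^k (1 - X)^2 x, x>], a second difference of [b].  Summed over [k] it
   telescopes. *)
Lemma altpow_defect k x : `|altpow k (x - adjoint T (T x))| ^+ 2 =
  (`|altpow k x| ^+ 2 - `|altpow k.+1 x| ^+ 2) -
  (`|altpow k.+1 x| ^+ 2 - `|altpow k.+2 x| ^+ 2).
Proof.
have -> : altpow k (x - adjoint T (T x)) = altpow k x + (-1) *: altpow k.+2 x.
  by rewrite addrC -scaleN1r altpow_linear altpow_shift addrC.
rewrite normDZ_sqr normrN1 expr1n mul1r rmorphN1 mulN1r altpow_dot.
rewrite rmorphN /= (_ : Num.conj (`|altpow k.+1 x| ^+ 2) = `|altpow k.+1 x| ^+ 2).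
  by ring.
by apply: CrealP; rewrite rpredX ?normr_real.
Qed.

Lemma cvg_altpow x : cvg ((fun k => `|altpow k x| ^+ 2 : R[i]^o) @ \oo).
Proof.
pose b k : R[i]^o := `|altpow k x| ^+ 2.
have bS k : b k.+1 <= b k by rewrite ler_pXn2r ?nnegrE// altpow_le.
have b_dec m n : (m <= n)%N -> b n <= b m.
  move/subnK <-; elim: (n - m)%N => [//|d IH]; exact: le_trans (bS _) IH.
have : cvg ((fun k => b 0%N - b k) @ \oo).
  apply: (@cvg_complex_bounded_mono _ _ (b 0%N)) => [n|m n mn|n].
  - by rewrite subr_ge0 b_dec.
  - by rewrite lerD2l lerN2 b_dec.
  - by rewrite lerBlDr lerDl exprn_ge0.
move=> bc; rewrite (_ : (fun k => _) = fun k => b 0%N - (b 0%N - b k)).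
  by apply: is_cvgB; [exact: is_cvg_cst|exact: bc].
by apply/funext => k; rewrite opprB addrC subrK.
Qed.

Definition defect_fun x : forall n : nat, H :=
  fun n => altpow n (x - adjoint T (T x)).

Lemma defect_sum x n : \sum_(k < n) `|defect_fun x k| ^+ 2 =
  (`|x| ^+ 2 - `|T x| ^+ 2) - (`|altpow n x| ^+ 2 - `|altpow n.+1 x| ^+ 2).
Proof.
elim: n => [|n IH]; first by rewrite big_ord0 subrr.
by rewrite big_ord_recr/= IH /defect_fun altpow_defect; ring.
Qed.

Lemma defect_summable x : square_summable (defect_fun x).
Proof.
exists (`|x| ^+ 2 - `|T x| ^+ 2) => n; rewrite defect_sum lerBlDr lerDl subr_ge0.
by rewrite ler_pXn2r ?nnegrE// altpow_le.
Qed.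

Definition defect_vec x : hsum (fun=> H) := HSum (defect_summable x).

Lemma defect_linear : linear defect_vec.
Proof.
move=> a x y; apply: hsum_ext => n /=; rewrite -altpow_linear; congr altpow.
by rewrite (linearP T) (linearP (adjoint T)) scalerBr opprD addrACA.
Qed.

(** [defect_vec] replaces the defect operator [(1 - T* T)^(1/2)] without taking a
   square root: for [X = T* T], [1 - X] is the sum of the positive operators
   [X^k (1 - X)^2], and each of these is [Z* Z] with [Z = altpow k (1 - X)].
   The remainder [<X^n (1 - X) x, x>] tends to [0] as the difference of two
   consecutive terms of a convergent sequence. *)
Lemma defect_normE x : `|defect_vec x| ^+ 2 = `|x| ^+ 2 - `|T x| ^+ 2.
Proof.
rewrite hsum_normE; apply: pdot_unique.
have -> : pdot (defect_vec x) (defect_vec x) = fun n =>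
    (`|x| ^+ 2 - `|T x| ^+ 2) - (`|altpow n x| ^+ 2 - `|altpow n.+1 x| ^+ 2).
  by apply/funext => n; rewrite pdotxx defect_sum.
rewrite -[X in _ --> X]subr0; apply: cvgB; first exact: cvg_cst.
have /cvg_ex[l bl] := @cvg_altpow x.
rewrite -(subrr l); apply: cvgB; first exact: bl.
by rewrite (cvg_shiftS (fun k => `|altpow k x| ^+ 2 : R[i]^o)).
Qed.

Lemma defect_exists : exists D : boundedOp H (hsum (fun=> H)),
  forall x, `|D x| ^+ 2 = `|x| ^+ 2 - `|T x| ^+ 2.
Proof.
have Db : exists M : R[i], forall x, `|defect_vec x| <= M * `|x|.
  exists 1 => x; rewrite mul1r -(@ler_pXn2r _ 2)// ?nnegrE// defect_normE.
  by rewrite lerBlDr lerDl exprn_ge0.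
by exists (bounded_linear defect_linear Db); exact: defect_normE.
Qed.

End Defect.

(** * Orthogonal projections and reflections *)

Section OrthogonalProjection.
Variables (R : realType) (F : hilbertType R).
Implicit Types (S : set F) (x y z : F).

Definition perp S : set F := [set y | forall s, S s -> '[y, s] = 0].

Lemma perpP S a y z : perp S y -> perp S z -> perp S (a *: y + z).
Proof.
move=> Sy Sz s Ss.
by rewrite hdotDl hdotZl Sy// Sz// addr0 mulr0.
Qed.

Lemma perp0 S : perp S 0. Proof. by move=> s _; rewrite linear0l. Qed.

Lemma perpZ S a y : perp S y -> perp S (a *: y).
Proof. by move=> Sy; rewrite -[_ *: _]addr0; exact: (perpP _ Sy (@perp0 S)). Qed.

Lemma perpB S y z : perp S y -> perp S z -> perp S (y - z).
Proof. by move=> Sy Sz; rewrite -scaleN1r addrC; exact: perpP. Qed.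

Lemma perp_perp S : S `<=` perp (perp S).
Proof. by move=> s Ss y Sy; rewrite hdotC Sy// rmorph0. Qed.

Lemma perp_cap S y : perp S y -> perp (perp S) y -> y = 0.
Proof.
move=> Sy Py; apply/eqP.
by rewrite -normr_eq0 -sqrf_eq0 -hdotE Py.
Qed.

(** A point of [perp S] nearly at minimal distance from [x] is nearly its
   projection. *)
Lemma perp_approx S x (e : R) : 0 < e ->
  exists2 y, perp S y & forall z, perp S z -> `|'[x - y, z]| <= e%:C%C * `|z|.
Proof.
move=> e0.
pose J y : R[i] := `|x - y| ^+ 2.
have JE y : J y = (complex.Re (J y))%:C%C.
  by rewrite RRe_real// rpredX// normr_real.
pose A := [set complex.Re (J y) | y in perp S].
have infA : has_inf A.
  split; first by exists (complex.Re (J 0)), 0 => //; exact: perp0.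
  by exists 0 => _ [y _ <-]; rewrite -lecR -JE exprn_ge0.
have [_ [y Sy <-] yA] := inf_adherent (exprn_gt0 2 e0) infA.
exists y => // z Sz.
have [->|z0] := eqVneq z 0; first by rewrite linear0r !normr0 mulr0.
rewrite -(@ler_pXn2r _ 2)// ?nnegrE ?mulr_ge0//; last by rewrite ler0c ltW.
rewrite exprMn; apply: polar_bound => [|a].
  by rewrite exprn_gt0// normr_gt0.
have h : J y <= J (y - a *: z) + e%:C%C ^+ 2.
  rewrite (JE y) (JE (y - _)) -rmorphXn -rmorphD lecR ltW// (lt_le_trans yA)//.
  rewrite lerD2r; apply: ge_inf; first exact: infA.2.
  by exists (y - a *: z) => //; apply: perpB => //; exact: perpZ.
move: h; rewrite /J opprB addrA addrAC normDZ_sqr -subr_ge0.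
by congr (0 <= _); ring.
Qed.

(** Completeness turns the approximate projections into an exact one: two of
   them, with errors [e n] and [e m], are at distance at most [e n + e m]. *)
Lemma perp_decomp S x : exists2 y, perp S y & perp (perp S) (x - y).
Proof.
pose e n : R := n.+1%:R^-1.
have e0 n : 0 < e n by rewrite invr_gt0.
have /choice[u uP] n : exists y, perp S y /\
    forall z, perp S z -> `|'[x - y, z]| <= (e n)%:C%C * `|z|.
  by have [y Sy yP] := perp_approx S x (e0 n); exists y.
have uE n m : `|u n - u m| <= (e n)%:C%C + (e m)%:C%C.
  have [->|d0] := eqVneq (u n - u m) 0.
    by rewrite normr0 addr_ge0// ler0c ltW.
  rewrite -(ler_pM2r (_ : 0 < `|u n - u m|)) ?normr_gt0// -expr2 -hdotE.
  set d := u n - u m.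
  have Sd : perp S d by apply: perpB; [exact: (uP n).1|exact: (uP m).1].
  have dd : '[d, d] = '[x - u m, d] - '[x - u n, d].
    by rewrite -hdotBl opprB [_ + (_ - x)]addrC addrA subrK.
  rewrite -(ger0_norm (_ : 0 <= '[d, d])); last by rewrite hdotE exprn_ge0.
  rewrite dd mulrDl; apply: le_trans (ler_normB _ _) _.
  by rewrite addrC; apply: lerD; [exact: (uP n).2|exact: (uP m).2].
have eC (d : R[i]) : 0 < d -> \forall n \near \oo, (e n)%:C%C < d.
  move=> d0; have dr : (complex.Re d)%:C%C = d.
    by rewrite RRe_real// ger0_real// ltW.
  have rd0 : 0 < complex.Re d by rewrite -ltcR dr.
  near=> n; rewrite -dr ltcR; near: n.
  exact: (near_infty_natSinv_lt (PosNum rd0)).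
have : cvg (u @ \oo).
  apply/cauchy_cvgP/cauchy_ballP => d d0.
  rewrite near_map2; near=> n m; rewrite -ball_normE/=.
  rewrite (le_lt_trans (uE _ _))// [d]splitr ltrD//.
    by near: n; apply: eC; exact: divr_gt0.
  by near: m; apply: eC; exact: divr_gt0.
move=> /cvg_ex[y uy].
have lim_dot z : (fun n => '[u n, z] : R[i]^o) @ \oo --> ('[y, z] : R[i]^o).
  apply/cvgrPdist_le => d d0.
  have z1 : 0 < `|z| + 1 by rewrite ltr_wpDl.
  move/cvgrPdist_le : uy => /(_ _ (divr_gt0 d0 z1)); apply: filterS => n un.
  rewrite -hdotBl (le_trans (cauchy_schwarz _ _))//.
  rewrite (le_trans (ler_wpM2r _ un))// mulrAC ler_pdivrMr// ler_pM2l//.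
  by rewrite lerDl.
have hd := @norm_hausdorff _ R[i]^o.
exists y => z Sz.
  apply: etrans (esym (cvg_lim hd (lim_dot z))) _.
  have -> : (fun n => '[u n, z] : R[i]^o) = fun=> 0.
    by apply/funext => n; exact: (uP n).1.
  exact: (cvg_lim hd (@cvg_cst _ _ _ _ _)).
apply/eqP; rewrite -normr_le0; apply/ler_addgt0Pl => d d0; rewrite addr0.
have z1 : 0 < `|z| + 1 by rewrite ltr_wpDl.
have d1 : 0 < d / 2 / (`|z| + 1) by rewrite !divr_gt0.
near \oo => n.
have yn : `|'[y, z] - '[u n, z]| <= d / 2.
  by near: n; move/cvgrPdist_le: (lim_dot z); apply; exact: divr_gt0.
have en : (e n)%:C%C <= d / 2 / (`|z| + 1).
  by apply/ltW; near: n; exact: eC.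
have -> : '[x - y, z] = '[x - u n, z] - ('[y, z] - '[u n, z]).
  by rewrite !hdotBl; ring.
rewrite (le_trans (ler_normB _ _))// [leRHS]splitr lerD//.
rewrite (le_trans ((uP n).2 z Sz))// (le_trans (ler_wpM2r _ en))//.
by rewrite mulrAC ler_pdivrMr// ler_pM2l ?divr_gt0// lerDl.
Unshelve. all: by end_near. Qed.

(** The orthogonal reflection that fixes [perp S] and changes the sign on the
   closed span of [S]. *)
Lemma reflection_exists S : exists2 V : 'B(F),
  (forall x y, '[V x, V y] = '[x, y]) &
  (forall y z, perp S y -> perp (perp S) z -> V (y + z) = y - z).
Proof.
have /choice[p pP] x : exists y, perp S y /\ perp (perp S) (x - y).
  by have [y] := perp_decomp S x; exists y.
have pE y z : perp S y -> perp (perp S) z -> p (y + z) = y.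
  move=> Sy Sz; have [Sp Sp'] := pP (y + z).
  apply/eqP; rewrite -subr_eq0; apply/eqP; apply: (perp_cap (perpB Sp Sy)).
  have -> : p (y + z) - y = z - (y + z - p (y + z)).
    by rewrite opprB addrCA opprD [- y - z]addrC addNKr.
  exact: perpB.
pose f x := p x - (x - p x).
have fE y z : perp S y -> perp (perp S) z -> f (y + z) = y - z.
  by move=> Sy Sz; rewrite /f pE// [y + z]addrC addrK.
have dec x : exists y z, [/\ x = y + z, perp S y & perp (perp S) z].
  have [Sp Sp'] := pP x; exists (p x), (x - p x); split=> //.
  by rewrite addrC subrK.
have fl : linear f.
  move=> a x x'.
  have [y [z [-> Sy Sz]]] := dec x; have [y' [z' [-> Sy' Sz']]] := dec x'.
  rewrite scalerDr addrACA !fE//; try exact: perpP.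
  by rewrite scalerBr opprD addrACA.
have fi x x' : '[f x, f x'] = '[x, x'].
  have [y [z [-> Sy Sz]]] := dec x; have [y' [z' [-> Sy' Sz']]] := dec x'.
  rewrite !fE// !hdotBl !hdotBr !hdotDl !hdotDr.
  rewrite (Sz _ Sy') (hdot_eq0C (Sz' _ Sy)).
  by rewrite subr0 sub0r opprK addr0 add0r.
by exists (isometric_op fl fi).
Qed.

End OrthogonalProjection.

(** * Correcting lifts by a reflection *)

Section Lifts.
Variables (R : realType) (H K : hilbertType R) (iota : {linear H -> K}).
Implicit Types (A : 'B(H)) (B : 'B(K)).

(** In the form [iota^* B = A iota^*], where the adjoint of [B] no longer occurs:
   the [H]-component of [B k] is the image under [A] of that of [k]. *)
Lemma is_liftP A B : is_lift iota A B <->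
  forall k h, '[B k, iota h] = '[k, iota (adjoint A h)].
Proof.
split=> [AB k h|AB h]; first by rewrite adjointP AB.
by apply: hdot_ext => k; rewrite -adjointP AB.
Qed.

Lemma lift_perp A B k : is_lift iota A B ->
  ortho_compl iota k -> ortho_compl iota (B k).
Proof. by move=> /is_liftP AB kH h; rewrite AB kH. Qed.

Hypothesis iota_iso : isometric_embedding iota.

Lemma embed_dot x y : '[iota x, iota y] = '[x, y].
Proof. exact: iota_iso. Qed.

Lemma ortho_decomp k : exists h x, k = iota h + x /\ ortho_compl iota x.
Proof.
pose J := isometric_op (fun a x y => linearP iota a x y) iota_iso.
exists (adjoint J k), (k - iota (adjoint J k)); split.
  by rewrite addrC subrK.
move=> h; rewrite hdotBl embed_dot hdotC -[iota h]/(J h) adjointP -hdotC.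
by rewrite subrr.
Qed.

End Lifts.

Section Correction.
Variables (R : realType) (H K : hilbertType R) (iota : {linear H -> K}).
Variables (Q T1 T2 : 'B(H)) (Vq V1 V2 : 'B(K)).
Hypothesis iota_iso : isometric_embedding iota.
Hypothesis relT : T1 \o T2 =1 Q \o T2 \o T1.
Hypothesis lq : isometric_lift iota Q Vq.
Hypothesis l1 : isometric_lift iota T1 V1.
Hypothesis l2 : isometric_lift iota T2 V2.

Let N := ortho_compl iota.
(* [P] and [P'] are isometries lifting the same contraction [T1 T2]; [t h] is
   the [H]-component of both [P (iota h)] and [P' (iota h)]. *)
Let P k := V1 (V2 k).
Let P' k := Vq (V2 (V1 k)).
Let t h := iota (T1 (T2 h)).

Hypothesis rel_perp : forall k, N k -> P k = P' k.
Hypothesis cross : forall h h', '[P (iota h) - t h, P' (iota h') - t h'] = 0.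

Let P_dot x y : '[P x, P y] = '[x, y].
Proof. by rewrite /P l1.2 l2.2. Qed.

Let P'_dot x y : '[P' x, P' y] = '[x, y].
Proof. by rewrite /P' lq.2 l2.2 l1.2. Qed.

Let P_perp k : N k -> N (P k).
Proof. by move=> Nk; apply: lift_perp l1.1 _; apply: lift_perp l2.1 _. Qed.

Let P_t h h' : '[P (iota h), iota h'] = '[t h, iota h'].
Proof.
have := (is_liftP _ _ _).1 l1.1; rewrite /P => ->.
have := (is_liftP _ _ _).1 l2.1 => ->.
by rewrite !(embed_dot iota_iso) -(adjointP T2) -(adjointP T1).
Qed.

Let P'_t h h' : '[P' (iota h), iota h'] = '[t h, iota h'].
Proof.
have := (is_liftP _ _ _).1 lq.1; rewrite /P' => ->.
have := (is_liftP _ _ _).1 l2.1 => ->.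
have := (is_liftP _ _ _).1 l1.1 => ->.
have -> : t h = iota (Q (T2 (T1 h))) by congr (iota _); exact: relT.
by rewrite !(embed_dot iota_iso) -(adjointP T1) -(adjointP T2) -(adjointP Q).
Qed.

Let cross_dot h h' : '[P (iota h), P' (iota h')] = '[t h, t h'].
Proof.
have := cross h h'; rewrite !hdotBl !hdotBr P_t.
rewrite (hdotC (t h) (P' _)) P'_t -hdotC subrr subr0.
by move/subr0_eq.
Qed.

(* The reflection along the vectors [w h] exchanges [P (iota h)] and
   [P' (iota h)]; the iterates under [P] are added so that it commutes with
   [P] on [N]. *)
Let w h := P (iota h) - P' (iota h).
Let S : set K := [set k | exists n h, k = iter n P (w h)].

Let S_w h : S (w h). Proof. by exists 0%N, h. Qed.

Let S_P s : S s -> S (P s).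
Proof. by move=> [n [h ->]]; exists n.+1, h. Qed.

Let S_ind (C : set K) : (forall h, C (w h)) ->
  (forall s, S s -> C s -> C (P s)) -> S `<=` C.
Proof.
move=> Cw CP _ [n [h ->]]; elim: n => [|n IH] /=; first exact: Cw.
by apply: CP => //; exists n, h.
Qed.

Let S_perp : S `<=` N.
Proof.
apply: S_ind => [h h'|s _]; last exact: P_perp.
by rewrite hdotBl P_t P'_t subrr.
Qed.

Let iota_perp h : perp S (iota h).
Proof. by move=> s /S_perp sN; apply: hdot_eq0C; exact: sN. Qed.

Let sum_perp h : perp S (P (iota h) + P' (iota h)).
Proof.
apply: S_ind => [h'|s /S_perp Ns _].
  rewrite hdotDl !hdotBr P_dot P'_dot (cross_dot h h').
  rewrite (hdotC (P' _)) (cross_dot h' h) -hdotC.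
  by rewrite addrA subrK subrr.
rewrite hdotDl P_dot rel_perp// P'_dot.
by rewrite (hdot_eq0C (Ns h)) addr0.
Qed.

Let P_perpS y : N y -> perp S y -> perp S (P y).
Proof.
move=> Ny Sy; apply: S_ind => [h|s Ss _]; last by rewrite P_dot Sy.
by rewrite hdotBr P_dot rel_perp// P'_dot subrr.
Qed.

(* [P] maps [S] into itself, so its adjoint maps [perp S] into itself. *)
Let P_perp_perpS z : perp (perp S) z -> perp (perp S) (P z).
Proof.
move=> Sz y Sy; rewrite /P !adjointP; apply: Sz => s Ss.
by apply: hdot_eq0C; rewrite -!adjointP; apply: hdot_eq0C; apply: Sy; exact: S_P.
Qed.

(** Let [V] be the orthogonal reflection that is [-1] on the closed span of [S].
   It fixes [H] since [S] is orthogonal to [H], and it sends [P (iota h)] to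
   [P' (iota h)]: their difference lies in [S], and their sum is orthogonal to
   [S] by [cross] and the equality of Gram matrices.  It commutes on [N] with
   [P], which there equals [P'].  Hence [V P = P' V] on the whole space.  As [V]
   is its own inverse, [W1 = V V1] and [W2 = V2 V] satisfy
   [W1 W2 = V P V = P' = Vq W2 W1], and they are still lifts because [V] fixes
   [H]. *)
Lemma correct_lifts : exists W1 W2 : 'B(K),
  [/\ isometric_lift iota T1 W1, isometric_lift iota T2 W2
    & W1 \o W2 =1 Vq \o W2 \o W1].
Proof.
have [V Vdot VE] := reflection_exists S.
have dec x : exists y z, [/\ x = y + z, perp S y & perp (perp S) z].
  by have [y Sy Sz] := perp_decomp S x; exists y, (x - y); rewrite addrC subrK.
have Vfix y : perp S y -> V y = y.
  by move=> Sy; rewrite -[in LHS](addr0 y) VE ?subr0//; exact: perp0.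
have VV x : V (V x) = x.
  have [y [z [-> Sy Sz]]] := dec x; rewrite VE// VE//.
    by rewrite opprK.
  by rewrite -scaleN1r; exact: perpZ.
have Vadj x y : '[V x, y] = '[x, V y] by rewrite -{1}(VV y) Vdot.
have Viota h : V (iota h) = iota h by exact: Vfix.
have VP x : N x -> V (P x) = P (V x) /\ N (V x).
  move=> Nx; have [y [z [xE Sy Sz]]] := dec x.
  have Nz : N z by move=> h; exact: Sz.
  have Ny : N y.
    move=> h; have := Nx h; rewrite xE hdotDl (Nz h) addr0; exact: id.
  split; last by move=> h; rewrite xE VE// hdotBl (Ny h) (Nz h) subrr.
  have PD a b : P (a + b) = P a + P b by rewrite /P !opD.
  have PB a b : P (a - b) = P a - P b by rewrite /P !opB.
  rewrite xE PD VE ?VE ?PB//; [exact: P_perpS|exact: P_perp_perpS].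
have half (x : K) : 2^-1 *: (x + x) = x.
  by rewrite scalerDr -scalerDl -[2^-1]mul1r -splitr scale1r.
have VPiota h : V (P (iota h)) = P' (iota h).
  have -> : P (iota h) =
      2^-1 *: (P (iota h) + P' (iota h)) + 2^-1 *: w h.
    by rewrite -scalerDr /w addrACA subrr addr0 half.
  rewrite VE; last by apply: perpZ; exact: perp_perp.
    rewrite -scalerBr /w opprB [X in _ *: (_ + X)]addrC addrACA subrr add0r.
    exact: half.
  exact: perpZ.
have VPE x : V (P x) = P' (V x).
  have [h [y [-> Ny]]] := ortho_decomp iota_iso x.
  have [VPy NVy] := VP _ Ny.
  have -> : V (iota h + y) = iota h + V y by rewrite opD Viota.
  have -> : P (iota h + y) = P (iota h) + P y by rewrite /P !opD.
  by rewrite opD VPiota VPy rel_perp// /P' !opD.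
have l12 x y : '[V (V1 x), V (V1 y)] = '[x, y].
  exact: etrans (Vdot _ _) (l1.2 _ _).
have l21 x y : '[V2 (V x), V2 (V y)] = '[x, y].
  exact: etrans (l2.2 _ _) (Vdot _ _).
have lin1 : linear (fun x => V (V1 x)) by move=> a x y; rewrite !linearP.
have lin2 : linear (fun x => V2 (V x)) by move=> a x y; rewrite !linearP.
exists (isometric_op lin1 l12), (isometric_op lin2 l21); split.
- split; last exact: l12.
  apply/is_liftP => k h; rewrite /= Vadj Viota.
  exact: (is_liftP _ _ _).1 l1.1 _ _.
- split; last exact: l21.
  apply/is_liftP => k h; rewrite /=.
  rewrite ((is_liftP _ _ _).1 l2.1) Vadj Viota.
  by [].
- by move=> k /=; rewrite VV -/(P (V k)) VPE VV.
Qed.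

End Correction.

(** * Isometric extensions *)

Section SequenceSpace.
Variables (R : realType) (Y : hilbertType R).
Notation X := (hsum (fun=> Y)).

Definition hemb (y : Y) : X := @hcons R (fun=> Y) y 0.
Definition hshift (u : X) : X := @hcons R (fun=> Y) 0 u.

Lemma hemb_linear : linear hemb.
Proof.
move=> a y z; rewrite -(@hconsP R (fun=> Y)).
by congr hcons; rewrite scaler0 addr0.
Qed.

Lemma hshift_linear : linear hshift.
Proof.
move=> a u v; rewrite -(@hconsP R (fun=> Y)).
by congr hcons; rewrite scaler0 addr0.
Qed.

HB.instance Definition _ := GRing.isLinear.Build R[i] Y X *:%R hemb hemb_linear.
HB.instance Definition _ := GRing.isLinear.Build R[i] X X *:%R hshift hshift_linear.

Lemma hemb_dot y z : '[hemb y, hemb z] = '[y, z].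
Proof. by rewrite hdot_cons linear0l addr0. Qed.

Lemma hshift_dot u v : '[hshift u, hshift v] = '[u, v].
Proof. by rewrite hdot_cons linear0l add0r. Qed.

Lemma dot_hemb (u : X) y : '[u, hemb y] = '[u 0%N, y].
Proof. by rewrite -{1}(hcons_eta u) hdot_cons linear0r addr0. Qed.

Lemma hshift_emb u y : '[hshift u, hemb y] = 0.
Proof. by rewrite dot_hemb linear0l. Qed.

Lemma hemb_shift y u : '[hemb y, hshift u] = 0.
Proof. by apply: hdot_eq0C; exact: hshift_emb. Qed.

End SequenceSpace.

Arguments hemb {R Y} y.
Arguments hshift {R Y} u.

Section Extension.
Variables (R : realType) (H Y : hilbertType R).
Notation X := (hsum (fun=> Y)).

(** [H] in position [0] followed by copies of [Y]: the sum is H (+) l2(Y). *)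
Definition ext_fam (n : nat) : hilbertType R := if n is _.+1 then Y else H.

Definition ext : hilbertType R := hsum ext_fam.

Definition hpair (h : H) (x : X) : ext := @hcons R ext_fam h x.
Definition hfst (k : ext) : H := k 0%N.
Definition hsnd (k : ext) : X := @htail R ext_fam k.

Lemma hpair_eta k : hpair (hfst k) (hsnd k) = k.
Proof. exact: (@hcons_eta R ext_fam k). Qed.

Lemma hfst_pair h x : hfst (hpair h x) = h. Proof. by []. Qed.

Lemma hsnd_pair h x : hsnd (hpair h x) = x.
Proof. exact: (@htail_cons R ext_fam h x). Qed.

Lemma hpairP a h h' x x' :
  hpair (a *: h + h') (a *: x + x') = a *: hpair h x + hpair h' x'.
Proof. exact: (@hconsP R ext_fam). Qed.

Lemma hfstP a k k' : hfst (a *: k + k') = a *: hfst k + hfst k'.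
Proof. by []. Qed.

Lemma hsndP a k k' : hsnd (a *: k + k') = a *: hsnd k + hsnd k'.
Proof. exact: (@htailP R ext_fam). Qed.

Lemma hpair_dot h h' x x' : '[hpair h x, hpair h' x'] = '[h, h'] + '[x, x'].
Proof. exact: (@hdot_cons R ext_fam). Qed.

Definition hincl (h : H) : ext := hpair h 0.

Lemma hincl_linear : linear hincl.
Proof.
by move=> a h h'; rewrite -hpairP; congr hpair; rewrite scaler0 addr0.
Qed.

HB.instance Definition _ := GRing.isLinear.Build R[i] H ext *:%R hincl hincl_linear.

Lemma hincl_isometric : isometric_embedding (hincl : {linear H -> ext}).
Proof. by move=> h h'; apply: etrans (hpair_dot _ _ _ _) _; rewrite linear0l addr0. Qed.

Lemma ortho_compl_pair k : ortho_compl (hincl : {linear H -> ext}) k ->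
  k = hpair 0 (hsnd k).
Proof.
move=> kP; rewrite -{1}(hpair_eta k); congr hpair.
have := kP (hfst k); rewrite -{1}(hpair_eta k) hpair_dot linear0r addr0 hdotE.
by move/eqP; rewrite sqrf_eq0 normr_eq0 => /eqP.
Qed.

(** The block operator with rows [T, 0] and [C, M].  It is lower triangular, hence a
   lift of [T]; it is isometric because [C] supplies the norm that [T] loses, in a
   place that [M] leaves free. *)
Lemma isometric_extension (T : 'B(H)) (C : {linear H -> X}) (M : {linear X -> X}) :
  (forall h, `|C h| ^+ 2 = `|h| ^+ 2 - `|T h| ^+ 2) ->
  (forall x y, '[M x, M y] = '[x, y]) -> (forall x h, '[M x, C h] = 0) ->
  exists2 V : 'B(ext), isometric_lift hincl T V &
    forall h x, V (hpair h x) = hpair (T h) (C h + M x).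
Proof.
move=> CT Mi MC.
pose f k := hpair (T (hfst k)) (C (hfst k) + M (hsnd k)).
have fl : linear f.
  move=> a k k'; rewrite /f hfstP hsndP -hpairP.
  by congr hpair; rewrite !linearP// scalerDr addrACA.
have fE k : `|f k| = `|k|.
  apply/eqP; rewrite -(@eqrXn2 _ 2)//; apply/eqP; rewrite -!hdotE.
  rewrite -(hpair_eta k); set h := hfst k; set x := hsnd k.
  rewrite /f hfst_pair hsnd_pair !hpair_dot hdotDl !hdotDr.
  rewrite Mi MC (hdot_eq0C (MC _ _)) !hdotE CT addr0 add0r addrA.
  by rewrite [`|T h| ^+ 2 + _]addrC subrK.
have fb : exists M : R[i], forall x, `|f x| <= M * `|x|.
  by exists 1 => k; rewrite mul1r fE.
pose V := bounded_linear fl fb.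
exists V; last by move=> h x; rewrite /= /f hfst_pair hsnd_pair.
split.
  apply/is_liftP => k h.
  rewrite -{2}(hpair_eta k) !hpair_dot !linear0r !addr0.
  exact: adjointP.
exact/isometry_normP.
Qed.

End Extension.

Arguments hincl {R H Y} h.

(** * Lifts of Ando type *)

Section AndoLifts.
Variables (R : realType) (H E : hilbertType R) (Q T1 T2 : 'B(H)).
Notation Y := (hsum (fun=> E)).
Notation X := (hsum (fun=> Y)).
Variables (D1 D2 : boundedOp H E) (j : {linear Y -> Y}) (c : {linear H -> Y}).

Hypothesis relT : T1 \o T2 =1 Q \o T2 \o T1.
Hypothesis D1E : forall h, `|D1 h| ^+ 2 = `|h| ^+ 2 - `|T1 h| ^+ 2.
Hypothesis D2E : forall h, `|D2 h| ^+ 2 = `|h| ^+ 2 - `|T2 h| ^+ 2.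
Hypothesis cE : forall h, `|c h| ^+ 2 = `|h| ^+ 2 - `|Q h| ^+ 2.
Hypothesis ji : forall x y, '[j x, j y] = '[x, y].
Hypothesis jc : forall x h, '[j x, c h] = 0.
Hypothesis shift_c : forall x h, '[hshift x, c h] = 0.
Hypothesis shift_j : forall x y z,
  '[hshift (hemb x + hshift (hemb y)), j (hemb z)] = 0.

(** The diagonal operator [M1] with entries [j^n a], where [a] is the double shift
   of [Y], is chosen so that [M1 S = J S M1] for the shift [S] of [X] and the
   diagonal operator [J] with entries [j]. *)
Fixpoint jpow n : {linear Y -> Y} :=
  if n is n'.+1 then j \o jpow n' else hshift \o hshift.

Let jpow_dot n x y : '[jpow n x, jpow n y] = '[x, y].
Proof. by elim: n => [|n IH] /=; rewrite ?ji// !hshift_dot. Qed.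

Let M1 : {linear X -> X} := @hdiag R (fun=> Y) jpow jpow_dot.
Definition diagj : {linear X -> X} := @hdiag R (fun=> Y) (fun=> j) (fun=> ji).
(* [C1] and [C2] land in the positions 1 and 0 of [Y], which the double shift
   leaves free; hence [C1], [M1 C2] and [C2] occupy the positions 1, 2 and 0. *)
Let C1 : {linear H -> X} := hemb \o hshift \o hemb \o D1.
Let C2 : {linear H -> X} := hemb \o hemb \o D2.
Let Cq : {linear H -> X} := hemb \o c.

Let M1_emb y : M1 (hemb y) = hemb (hshift (hshift y)).
Proof. by apply: hsum_ext => -[|n] //; rewrite /= !linear0. Qed.

Let J_emb y : diagj (hemb y) = hemb (j y).
Proof. by apply: hsum_ext => -[|n] //; rewrite /= !linear0. Qed.

Let M1_shift x : M1 (hshift x) = diagj (hshift (M1 x)).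
Proof. by apply: hsum_ext => -[|n] //; rewrite /= !linear0. Qed.

Let J_shift x : diagj (hshift x) = hshift (diagj x).
Proof. by apply: hsum_ext => -[|n] //; rewrite /= !linear0. Qed.

(** On H (+) X take the extensions V1 = (T1, C1; M1), V2 = (T2, C2; S) and
   Vq = (Q, c; J).  They satisfy V1 V2 = Vq V2 V1 on X by the choice of [M1].  On [H]
   the components along X of the two sides are orthogonal: in position 0 of X by
   [shift_c] and [shift_j], and the left one vanishes in position 1, the only other
   place where the right one lives.  So [correct_lifts] applies, and it leaves
   [Vq] untouched, which keeps its explicit form. *)
Lemma ando_lifts : exists Vq V1 V2 : 'B(ext H Y),
  [/\ isometric_lift hincl Q Vq, isometric_lift hincl T1 V1,
      isometric_lift hincl T2 V2,
      V1 \o V2 =1 Vq \o V2 \o V1 &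
      forall h x, Vq (hpair h x) = hpair (Q h) (hemb (c h) + diagj x)].
Proof.
have [V1 l1 V1E] : exists2 V : 'B(ext H Y), isometric_lift hincl T1 V &
    forall h x, V (hpair h x) = hpair (T1 h) (C1 h + M1 x).
  apply: isometric_extension => [h|x y|x h].
  - by rewrite -D1E; apply: eq_dot_norm2; rewrite hemb_dot hshift_dot hemb_dot.
  - exact: hdiag_dot.
  - by rewrite dot_hemb /= hshift_dot hshift_emb.
have [V2 l2 V2E] : exists2 V : 'B(ext H Y), isometric_lift hincl T2 V &
    forall h x, V (hpair h x) = hpair (T2 h) (C2 h + hshift x).
  apply: isometric_extension => [h|x y|x h].
  - by rewrite -D2E; apply: eq_dot_norm2; rewrite !hemb_dot.
  - exact: hshift_dot.
  - exact: hshift_emb.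
have [Vq lq VqE] : exists2 V : 'B(ext H Y), isometric_lift hincl Q V &
    forall h x, V (hpair h x) = hpair (Q h) (Cq h + diagj x).
  apply: isometric_extension => [h|x y|x h].
  - by rewrite -cE; apply: eq_dot_norm2; rewrite hemb_dot.
  - exact: hdiag_dot.
  - by rewrite dot_hemb /= jc.
have [] := @correct_lifts R H (ext H Y) hincl Q T1 T2 Vq V1 V2 _ relT lq l1 l2.
- exact: hincl_isometric.
- move=> k /ortho_compl_pair ->; rewrite V2E V1E V1E V2E VqE.
  by rewrite !linear0 !add0r M1_shift.
- move=> h h'; have iE x : (hincl : {linear H -> ext H Y}) x = hpair x 0 by [].
  rewrite !iE V2E V1E V1E V2E VqE.
  rewrite -[T1 (T2 h')]/((T1 \o T2) h') relT /=.
  have pB (x y : H) u : hpair x u - hpair x (0 : X) = hpair 0 u.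
    by rewrite addrC -scaleN1r -hpairP scaleN1r addNr scaler0 add0r.
  rewrite !pB// hpair_dot linear0l add0r !linear0 !addr0.
  rewrite -[hdiag jpow_dot _]/(M1 _) -[hdiag _ (_ + _)]/(diagj _).
  rewrite (linearD diagj) M1_emb J_emb J_shift.
  have := shift_j (D1 (T2 h)) (D2 h) (D2 (T1 h')).
  rewrite (linearD hshift) hdotDl => cr.
  rewrite !hdotDl !hdotDr !hemb_dot !hemb_shift !shift_c !add0r !addr0.
  exact: cr.
- move=> W1 [W2 [L1 L2 rel]]; exists Vq, W1, W2; split=> //.
Qed.

End AndoLifts.

Theorem theorem5p2 (R : realType) (H : hilbertType R) (Q T1 T2 : 'B(H)) :
  contractive Q -> contractive T1 -> contractive T2 ->
  T1 \o T2 =1 Q \o T2 \o T1 ->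
  (exists (K : hilbertType R) (iota : {linear H -> K}) (Qbar V1 V2 : 'B(K)),
     [/\ isometric_embedding iota,
         isometric_lift iota Q Qbar,
         isometric_lift iota T1 V1,
         isometric_lift iota T2 V2
       & V1 \o V2 =1 Qbar \o V2 \o V1]) /\
  (isometry (@hdot R H) (@hdot R H) Q ->
   forall q : R[i], `|q| = 1 ->
   exists (K : hilbertType R) (iota : {linear H -> K}) (Qbar V1 V2 : 'B(K)),
     [/\ isometric_embedding iota,
         isometric_lift iota Q Qbar /\ is_dsum_scalar iota Q q Qbar,
         isometric_lift iota T1 V1,
         isometric_lift iota T2 V2
       & V1 \o V2 =1 Qbar \o V2 \o V1]).
Proof.
move=> cQ c1 c2 relT.
have [D1 D1E] := defect_exists c1.
have [D2 D2E] := defect_exists c2.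
set E := hsum _ in D1 D1E D2 D2E.
pose K := ext H (hsum (fun=> E)).
split=> [|Qi q q1].
  (* [j] moves past the positions 0 to 2 of [Y]; position 0 receives the defect
     of [Q]. *)
  have [Dq DqE] := defect_exists cQ.
  pose j : {linear hsum (fun=> E) -> hsum (fun=> E)} := hshift \o hshift \o hshift.
  pose c : {linear H -> hsum (fun=> E)} := hemb \o Dq.
  have ji x y : '[j x, j y] = '[x, y] by rewrite !hshift_dot.
  have [h|x h|x h|x y z|Vq [V1 [V2 [lq l1 l2 rel _]]]] :=
    @ando_lifts R H E Q T1 T2 D1 D2 j c relT D1E D2E _ ji.
  - rewrite -DqE; apply: eq_dot_norm2; exact: hemb_dot.
  - exact: hshift_emb.
  - exact: hshift_emb.
  - by rewrite hshift_dot hdotDl hshift_dot !hemb_shift add0r.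
  - by exists K, hincl, Vq, V1, V2; split=> //; exact: hincl_isometric.
(* An isometry [Q] has no defect, so that nothing but [q] needs to sit below
   it. *)
pose j : {linear hsum (fun=> E) -> hsum (fun=> E)} := *:%R q.
pose c : {linear H -> hsum (fun=> E)} := \0.
have ji x y : '[j x, j y] = '[x, y].
  by rewrite hdotZl hdotZr mulrA -normCK q1 expr1n mul1r.
have [h|x h|x h|x y z|Vq [V1 [V2 [lq l1 l2 rel VqE]]]] :=
  @ando_lifts R H E Q T1 T2 D1 D2 j c relT D1E D2E _ ji.
- by rewrite (isometry_normP Q).1// subrr normr0 expr0n.
- exact: linear0r.
- exact: linear0r.
- by rewrite hdotZr hshift_emb mulr0.
exists K, hincl, Vq, V1, V2; split=> //; first exact: hincl_isometric.
split=> // h k /ortho_compl_pair ->.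
have inclD x u : hincl x + hpair 0 u = hpair x u :> K.
  by rewrite -[hincl x]scale1r -hpairP scale1r addr0 scaler0 add0r.
have pairZ u : q *: hpair 0 u = hpair 0 (q *: u) :> K.
  by apply: hsum_ext => -[|n] //; exact: scaler0.
rewrite pairZ !inclD VqE linear0 add0r; congr hpair.
exact: hsum_ext.
Qed.
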